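(* The nerve functor $N$ from the category of $\mathrm{Strat}_\otimes$-categories and $\mathrm{Strat}_\otimes$-enriched functors to the category of simplicial sets is faithful.
   Context: **Stratified sets.** For $n\ge 0$ let $[n]=\{0<1<\dots<n\}$; simplicial operators are order preserving maps, acting on simplices on the right. A stratified set is a simplicial set $X$ with a subset $tX$ of its simplices (the thin ones) containing all degenerate simplices and no $0$-simplices. A stratified map is a simplicial map carrying thin simplices to thin simplices; $\mathrm{Strat}$ is the resulting category. A stratified subset $X\subseteq Y$ is a simplicial subset with $tX\subseteq tY$; it is regular if $tX=X\cap tY$. $\Delta[n]$ denotes the standard simplex in which only degenerate simplices are thin. **Lax Gray tensor.** $X\otimes Y$ has underlying simplicial set $X\times Y$, and an $n$-simplex $(x,y)$ is thin iff for every $p,q\ge0$ with $p+q=n$ either $x\cdot\bot_1^{p,q}$ is thin in $X$ or $y\cdot\bot_2^{p,q}$ is thin in $Y$, where $\bot_1^{p,q}\colon[p]\to[n]$, $i\mapsto i$, and $\bot_2^{p,q}\colon[q]\to[n]$, $j\mapsto j+p$. This is a monoidal structure on $\mathrm{Strat}$ with unit $\Delta[0]$ and the associativity isomorphisms of $\times$. $\mathrm{Strat}_\otimes$-categories and functors are categories and functors enriched in $(\mathrm{Strat},\otimes,\Delta[0])$. **Homotopy coherent paths.** Let $\bar{\mathbb{S}}$ be the locally ordered category with integers as objects, with $\bar{\mathbb{S}}(r,s)=\emptyset$ if $s<r$, $\bar{\mathbb{S}}(r,r)=\{()\}$, and for $r<s$ $\bar{\mathbb{S}}(r,s)$ the set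 of tuples $(a_s,a_{s-1},\dots,a_{r+1})\in\{0,1\}^{s-r}$ with $a_s=0$, ordered pointwise; composition is concatenation $(b_t,\dots,b_{s+1})\circ(a_s,\dots,a_{r+1})=(b_t,\dots,b_{s+1},a_s,\dots,a_{r+1})$. Write $\langle r,s\rangle=(0,1,\dots,1)\in\bar{\mathbb{S}}(r,s)$ for $r<s$ and $\langle r,r\rangle=()$. Every arrow is uniquely a composite of arrows $\langle r,s\rangle$ with $r<s$. Let $\bar{\mathbb{S}}[n]$ be the full subcategory on $0,\dots,n$. An operator $\alpha\colon[n]\to[m]$ induces the locally ordered functor $\bar{\mathbb{S}}(\alpha)\colon\bar{\mathbb{S}}[n]\to\bar{\mathbb{S}}[m]$ acting as $\alpha$ on objects and with $\langle r,s\rangle\mapsto\langle\alpha(r),\alpha(s)\rangle$. Applying the categorical nerve to homsets gives simplicially enriched categories $\mathbb{S}[n]$, with $\mathbb{S}(r,s)$ a simplicial subset of $\Delta[1]^{s-r}$: the tuples $(\alpha_s,\dots,\alpha_{r+1})$ of simplices of $\Delta[1]$ with $\alpha_s$ constant at $0$. Let $\mathbb{S}_\otimes[n]$ be the $\mathrm{Strat}_\otimes$-category obtained by stratifying each $\mathbb{S}(r,s)$ as a regular subset of the iterated lax tensor $\Delta[1]^{\otimes(s-r)}$. The functors induced by operators respect these stratifications, giving a functor $\mathbb{S}_\otimes$ from $\Delta$ to $\mathrm{Strat}_\otimes$-categories. **Nerve.** For a $\mathrm{Strat}_\otimes$-category $\mathcal{E}$, $N(\mathcal{E})$ is the simplicial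 set whose $n$-simplices are the $\mathrm{Strat}_\otimes$-functors $f\colon\mathbb{S}_\otimes[n]\to\mathcal{E}$, with $f\cdot\alpha=f\circ\mathbb{S}_\otimes(\alpha)$; it is functorial by post-composition. *)

(* Defs.v *)
(* Mathematical Components; classical axioms from mathcomp.classical.boolp. *)
From HB Require Import structures.
From mathcomp Require Import all_boot all_order boolp zify.

Set Implicit Arguments.
Unset Strict Implicit.
Unset Printing Implicit Defensive.

Import Order.Theory Order.DefaultSeqProdOrder.

Local Obligation Tactic := idtac.

Record category := Category {
  Ob : Type;
  Hom : Ob -> Ob -> Type;
  idm : forall x, Hom x x;
  compm : forall x y z, Hom y z -> Hom x y -> Hom x z;
  compm1 : forall x y (f : Hom x y), compm f (idm x) = f;
  comp1m : forall x y (f : Hom x y), compm (idm y) f = f;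
  compmA : forall x y z w (h : Hom z w) (g : Hom y z) (f : Hom x y),
    compm h (compm g f) = compm (compm h g) f }.
Arguments idm {c} x.
Arguments compm {c x y z} g f : rename.

Record functor (C D : category) := Functor {
  on_ob : Ob C -> Ob D;
  on_hom : forall x y, Hom x y -> Hom (on_ob x) (on_ob y);
  on_hom1 : forall x, on_hom (idm x) = idm (on_ob x);
  on_homM : forall x y z (g : Hom y z) (f : Hom x y),
    on_hom (compm g f) = compm (on_hom g) (on_hom f) }.
Arguments on_ob {C D} F x : rename.
Arguments on_hom {C D} F {x y} f : rename.

Definition faithful (C D : category) (F : functor C D) : Prop :=
  forall (x y : Ob C) (f g : Hom x y), on_hom F f = on_hom F g -> f = g.

Section Omorphisms.
Context {d d' : Order.disp_t} {P : porderType d} {Q : porderType d'}.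

Definition omk (f : P -> Q) (hf : {homo f : x y / (x <= y)%O}) :
    {omorphism P -> Q} :=
  HB.pack f (Order.isOrderMorphism.Build d P d' Q f hf).

Lemma omorphism_ext (f g : {omorphism P -> Q}) : f =1 g -> f = g.
Proof.
case: f g => [f [[hf]]] [g [[hg]]] /= e.
have {}e : f = g by apply: funext.
by subst g; rewrite (Prop_irrelevance hf hg).
Qed.

End Omorphisms.

(* Simplicial operators [m] -> [n], with [n] = {0 < ... < n} rendered as 'I_n.+1. *)
Notation operator m n := {omorphism 'I_m.+1 -> 'I_n.+1}.

Definition oid d (P : porderType d) : {omorphism P -> P} := idfun.

Definition ocomp d d' d'' (P : porderType d) (Q : porderType d')
  (R : porderType d'') (g : {omorphism Q -> R}) (f : {omorphism P -> Q}) :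
  {omorphism P -> R} := g \o f.

Record sset := SSet {
  simp :> nat -> Type;
  act : forall m n, simp n -> operator m n -> simp m;
  act1 : forall n (x : simp n), act x (oid _) = x;
  actM : forall k m n (x : simp n) (a : operator m n) (b : operator k m),
    act x (ocomp a b) = act (act x a) b }.
Arguments act {s m n} x a : rename.

Record smap (X Y : sset) := SMap {
  sfun :> forall n, X n -> Y n;
  sfun_nat : forall m n (x : X n) (a : operator m n),
    sfun (act x a) = act (sfun x) a }.

Lemma smap_ext X Y (f g : smap X Y) : (forall n (x : X n), f n x = g n x) -> f = g.
Proof.
case: f g => [f hf] [g hg] /= e.
have {}e : f = g by apply: functional_extensionality_dep => n; apply: funext.
by subst g; rewrite (Prop_irrelevance hf hg).
Qed.

Definition smap_id X : smap X X := @SMap X X (fun n x => x) (fun _ _ _ _ => erefl).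

Program Definition smap_comp X Y Z (g : smap Y Z) (f : smap X Y) : smap X Z :=
  @SMap X Z (fun n x => g n (f n x)) _.
Next Obligation. by move=> X Y Z g f m n x a /=; rewrite !sfun_nat. Qed.

Program Definition sset_cat : category :=
  @Category sset smap smap_id smap_comp _ _ _.
Next Obligation. by move=> X Y f; apply: smap_ext. Qed.
Next Obligation. by move=> X Y f; apply: smap_ext. Qed.
Next Obligation. by move=> X Y Z W h g f; apply: smap_ext. Qed.

Definition degenerate (X : sset) n (x : X n) : Prop :=
  exists m (s : operator n m) (y : X m),
    [/\ m < n, (forall j, exists i, s i = j) & x = act y s].

Lemma smap_degenerate X Y (f : smap X Y) n (x : X n) :
  degenerate x -> degenerate (f n x).
Proof.
by case=> m [s [y [lt_mn sur ->]]]; exists m, s, (f m y); split; rewrite ?sfun_nat.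
Qed.

Program Definition nerve_poset d (P : porderType d) : sset :=
  @SSet (fun n => {omorphism 'I_n.+1 -> P}) (fun m n x a => ocomp x a) _ _.
Next Obligation. by move=> d P n x; apply: omorphism_ext. Qed.
Next Obligation. by move=> d P k m n x a b; apply: omorphism_ext. Qed.

Lemma ord_le n (i j : 'I_n) : (i <= j)%O = (i <= j)%N.
Proof. by []. Qed.

Lemma op_le m n (a : operator m n) (i j : 'I_m.+1) : i <= j -> a i <= a j.
Proof. by move=> le_ij; rewrite -ord_le; apply: omorph_le. Qed.

(* An operator with two equal consecutive values factors through a codegeneracy. *)
Lemma degenerate_step (X : sset) m n (x : X m) (a : operator n m) (i : nat) :
  i < n -> a (inord i) = a (inord i.+1) -> degenerate (act x a).
Proof.
case: n a => [|n] a // lt_in eqa.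
pose sf (j : 'I_n.+2) : 'I_n.+1 := inord (if j <= i then j : nat else j.-1).
pose df (j : 'I_n.+1) : 'I_n.+2 := inord (if j <= i then j : nat else j.+1).
have sfE j : sf j = (if j <= i then j : nat else j.-1) :> nat.
  by rewrite /sf inordK //; have := ltn_ord j; case: ifP; lia.
have dfE j : df j = (if j <= i then j : nat else j.+1) :> nat.
  by rewrite /df inordK //; have := ltn_ord j; case: ifP; lia.
have hs : {homo sf : x y / (x <= y)%O}.
  by move=> j k; rewrite !ord_le !sfE; do 2![case: ifP]; lia.
have hd : {homo df : x y / (x <= y)%O}.
  by move=> j k; rewrite !ord_le !dfE; do 2![case: ifP]; lia.
exists n, (omk hs), (act x (ocomp a (omk hd))); split=> //.
  move=> j; exists (df j); apply: val_inj => /=; rewrite sfE dfE.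
  by case: (leqP j i) => h; rewrite ?h //; case: ifP; lia.
rewrite -actM; congr act; apply: omorphism_ext => j /=.
have [ej|nj] := eqVneq (j : nat) i.+1.
  have -> : j = inord i.+1 by apply: val_inj; rewrite /= inordK // -ej.
  rewrite -eqa; congr (a _); apply: val_inj => /=.
  by rewrite dfE sfE !inordK ?ltnn /= ?leqnn //; lia.
congr (a _); apply: val_inj => /=; rewrite dfE sfE.
by case: (leqP j i) => h; rewrite ?h //; case: ifP; lia.
Qed.

(* A surjection lowering the dimension has two equal consecutive values. *)
Lemma op_collapse n m (s : operator n m) :
  m < n -> exists2 i, i < n & s (inord i) = s (inord i.+1).
Proof.
move=> lt_mn; case: (pselect (exists2 i, i < n & s (inord i) = s (inord i.+1))) => //.
move=> no; exfalso.
suff H i : i <= n -> i <= s (inord i).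
  by have := H n (leqnn n); have := ltn_ord (s (inord n)); lia.
elim: i => // i IH lt_in; have /IH h : i <= n by lia.
have : s (inord i) <= s (inord i.+1) by apply: op_le; rewrite !inordK; lia.
case: (eqVneq (s (inord i)) (s (inord i.+1))) => [e|/eqP ne]; first by case: no; exists i.
have : (s (inord i) : nat) <> s (inord i.+1) by move=> e; apply: ne; apply: val_inj.
lia.
Qed.

Record strat := Strat {
  under :> sset;
  thin : forall n, under n -> Prop;
  thin_degenerate : forall n (x : under n), degenerate x -> thin x;
  nthin0 : forall x : under 0, ~ thin x }.

Record stmap (X Y : strat) := STMap {
  stfun :> smap X Y;
  stfun_thin : forall n (x : X n), thin x -> thin (stfun n x) }.

Lemma stmap_ext (X Y : strat) (f g : stmap X Y) :
  (forall n (x : X n), f n x = g n x) -> f = g.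
Proof.
case: f g => [f hf] [g hg] /= /smap_ext e; subst g.
by rewrite (Prop_irrelevance hf hg).
Qed.

Program Definition stmap_id (X : strat) : stmap X X := @STMap X X (smap_id X) _.
Next Obligation. by []. Qed.

Program Definition stmap_comp (X Y Z : strat) (g : stmap Y Z) (f : stmap X Y) :
  stmap X Z := @STMap X Z (smap_comp g f) _.
Next Obligation. by move=> X Y Z g f n x tx; do 2!apply: stfun_thin. Qed.

Lemma ndegenerate0 (X : sset) (x : X 0) : ~ degenerate x.
Proof. by case=> m [s [y []]]. Qed.

Definition Delta (k : nat) : strat :=
  @Strat (nerve_poset 'I_k.+1) (@degenerate _) (fun n x d => d) (@ndegenerate0 _).

(* For an injective f this is the regular stratified subset of Y carried by X:
   the thin simplices of X are those which are thin in Y. *)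
Program Definition strat_along (X : sset) (Y : strat) (f : smap X Y) : strat :=
  @Strat X (fun n x => thin (f n x)) _ _.
Next Obligation.
by move=> X Y f n x dx; apply/thin_degenerate/smap_degenerate.
Qed.
Next Obligation. by move=> X Y f x; apply: nthin0. Qed.

Lemma bot1_subproof p q n (e : p + q = n) :
  {homo (fun i : 'I_p.+1 => inord i : 'I_n.+1) : x y / (x <= y)%O}.
Proof.
move=> i j; rewrite !ord_le !inordK //; have := ltn_ord i; have := ltn_ord j; lia.
Qed.
Definition bot1 p q n (e : p + q = n) : operator p n := omk (bot1_subproof e).

Lemma bot2_subproof p q n (e : p + q = n) :
  {homo (fun j : 'I_q.+1 => inord (j + p) : 'I_n.+1) : x y / (x <= y)%O}.
Proof.
move=> i j; rewrite !ord_le !inordK //; have := ltn_ord i; have := ltn_ord j; lia.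
Qed.
Definition bot2 p q n (e : p + q = n) : operator q n := omk (bot2_subproof e).

Program Definition sset_prod (X Y : sset) : sset :=
  @SSet (fun n => (X n * Y n)%type) (fun m n x a => (act x.1 a, act x.2 a)) _ _.
Next Obligation. by move=> X Y n [x y]; rewrite /= !act1. Qed.
Next Obligation. by move=> X Y k m n [x y] a b; rewrite /= !actM. Qed.

Program Definition tensor (X Y : strat) : strat :=
  @Strat (sset_prod X Y)
    (fun n x => forall p q (e : p + q = n),
      thin (act x.1 (bot1 e)) \/ thin (act x.2 (bot2 e))) _ _.
Next Obligation.
move=> X Y n x [m [s [y [lt_mn _ ->]]]] p q e /=.
have [i lt_in eqs] := op_collapse s lt_mn.
rewrite -!actM; have [lt_ip|le_pi] := ltnP i p.
  left; apply: thin_degenerate; apply: (@degenerate_step _ _ _ _ _ i) => //=.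
  by rewrite !inordK //; lia.
right; apply: thin_degenerate; apply: (@degenerate_step _ _ _ _ _ (i - p)) => /=.
  by lia.
have lt_q : i - p < q by lia.
by rewrite (@inordK q (i - p)) ?(@inordK q (i - p).+1) ?addSn ?subnK //; lia.
Qed.
Next Obligation.
by move=> X Y x /(_ 0 0 erefl) [] /nthin0.
Qed.

(* The diagrams are spelled out on simplices; the associator is that of the cartesian
   product, and an n-simplex u of the unit Delta 0 is unique. *)
Record strat_category := StratCategory {
  obj :> Type;
  hom : obj -> obj -> strat;
  cid : forall x, stmap (Delta 0) (hom x x);
  ccomp : forall x y z, stmap (tensor (hom y z) (hom x y)) (hom x z);
  ccomp1 : forall x y n (f : hom x y n) (u : Delta 0 n),
    ccomp x x y n (f, cid x n u) = f;
  c1comp : forall x y n (f : hom x y n) (u : Delta 0 n),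
    ccomp x y y n (cid y n u, f) = f;
  ccompA : forall x y z w n (h : hom z w n) (g : hom y z n) (f : hom x y n),
    ccomp x z w n (h, ccomp x y z n (g, f)) =
    ccomp x y w n (ccomp y z w n (h, g), f) }.

Record strat_functor (E E' : strat_category) := StratFunctor {
  fobj :> E -> E';
  fhom : forall x y, stmap (hom x y) (hom (fobj x) (fobj y));
  fhom1 : forall x n (u : Delta 0 n), fhom x x n (cid x n u) = cid (fobj x) n u;
  fhomM : forall x y z n (g : hom y z n) (f : hom x y n),
    fhom x z n (ccomp x y z n (g, f)) =
    ccomp (fobj x) (fobj y) (fobj z) n (fhom y z n g, fhom x y n f) }.
Arguments fhom {E E'} F x y : rename.

Lemma StratFunctor_ext (E E' : strat_category) (fo : E -> E')
    (h k : forall x y, stmap (hom x y) (hom (fo x) (fo y))) h1 hM k1 kM :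
  (forall x y n (f : hom x y n), h x y n f = k x y n f) ->
  @StratFunctor E E' fo h h1 hM = @StratFunctor E E' fo k k1 kM.
Proof.
move=> e; have {}e : h = k.
  do 2!apply: functional_extensionality_dep => ?.
  by apply: stmap_ext.
by subst k; rewrite (Prop_irrelevance h1 k1) (Prop_irrelevance hM kM).
Qed.

Program Definition strat_functor_id (E : strat_category) : strat_functor E E :=
  @StratFunctor E E (fun x => x) (fun x y => stmap_id _) _ _.
Next Obligation. by []. Qed.
Next Obligation. by []. Qed.

Program Definition strat_functor_comp (E E' E'' : strat_category)
    (G : strat_functor E' E'') (F : strat_functor E E') : strat_functor E E'' :=
  @StratFunctor E E'' (fun x => G (F x))
    (fun x y => stmap_comp (fhom G (F x) (F y)) (fhom F x y)) _ _.
Next Obligation. by move=> E E' E'' G F x n u /=; rewrite !fhom1. Qed.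
Next Obligation. by move=> E E' E'' G F x y z n g f /=; rewrite !fhomM. Qed.

Program Definition strat_cat_cat : category :=
  @Category strat_category strat_functor strat_functor_id strat_functor_comp _ _ _.
Next Obligation. by move=> E E' [F h h1 hM]; apply: StratFunctor_ext. Qed.
Next Obligation. by move=> E E' [F h h1 hM]; apply: StratFunctor_ext. Qed.
Next Obligation. by move=> A B C D H G F; apply: StratFunctor_ext. Qed.

(* An arrow r -> s is the word [:: a_s; a_(s-1); ...; a_(r+1)] over {0 < 1} = 'I_2,
   with a_s = 0 when r < s, so that a_i is the entry of index s - i; there is no
   arrow when s < r.  Words of equal size are ordered pointwise. *)
Definition arrow_pred (r s : nat) (w : seq 'I_2) : bool :=
  [&& r <= s, size w == s - r & head ord0 w == ord0].

Record arrow (r s : nat) :=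
  Arrow { word :> seq 'I_2; arrowP : arrow_pred r s word }.

HB.instance Definition _ r s := [isSub for @word r s].
HB.instance Definition _ r s := [Choice of arrow r s by <:].
HB.instance Definition _ r s :=
  [SubChoice_isSubPOrder of arrow r s by <: with Order.Disp tt tt].

Lemma size_arrow r s (a : arrow r s) : size a = s - r.
Proof. by have /and3P[_ /eqP]  := arrowP a. Qed.

Lemma arrow_leq r s (a : arrow r s) : r <= s.
Proof. by have /and3P[]  := arrowP a. Qed.

Lemma arrow_head r s (a : arrow r s) : head ord0 a = ord0.
Proof. by have /and3P[_ _ /eqP]  := arrowP a. Qed.

Lemma arrow_ext r s (a b : arrow r s) :
  (forall k, k < s - r -> nth ord0 a k = nth ord0 b k) -> a = b.
Proof.
move=> e; apply: val_inj; apply: (@eq_from_nth _ ord0); rewrite /= !size_arrow //.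
Qed.

Lemma arrow_leP r s (a b : arrow r s) :
  reflect (forall k, nth ord0 a k <= nth ord0 b k) (a <= b)%O.
Proof.
rewrite -Order.le_val /=; have := size_arrow b; rewrite -(size_arrow a).
case: a b => [a _] [b _] /=; elim: a b => [|x a IH] [|y b] //= => [_|[e]].
  by apply: (iffP idP) => // _ k; rewrite nth_nil.
rewrite le_cons; apply: (iffP andP) => [[le_xy /(IH _ e) h] [|k]|h].
- exact: le_xy.
- exact: h.
by split; [exact: (h 0) | apply/(IH _ e) => k; exact: (h k.+1)].
Qed.

Program Definition arrow_id r : arrow r r := @Arrow r r [::] _.
Next Obligation. by move=> r; rewrite /arrow_pred leqnn subnn. Qed.

Program Definition arrow_comp r s t (b : arrow s t) (a : arrow r s) : arrow r t :=
  @Arrow r t (word b ++ word a) _.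
Next Obligation.
move=> r s t b a; have := arrow_leq a; have := arrow_leq b => h1 h2.
apply/and3P; split; first by lia.
  by rewrite size_cat !size_arrow; apply/eqP; lia.
by have := arrow_head b; case: (word b) => [|x w] /= h; apply/eqP; rewrite ?arrow_head.
Qed.

(* The arrow <r,s>. *)
Definition gen_word (k : nat) : seq 'I_2 :=
  if k is k'.+1 then ord0 :: nseq k' ord_max else [::].

Program Definition arrow_gen r s (le_rs : r <= s) : arrow r s :=
  @Arrow r s (gen_word (s - r)) _.
Next Obligation.
move=> r s le_rs; rewrite /arrow_pred le_rs /=.
by case: (s - r) => //= k; rewrite size_nseq !eqxx.
Qed.

Lemma nth_arrow_comp r s t (b : arrow s t) (a : arrow r s) k :
  nth ord0 (arrow_comp b a) k =
    if k < t - s then nth ord0 b k else nth ord0 a (k - (t - s)).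
Proof. by rewrite nth_cat size_arrow. Qed.

Lemma arrow_comp_le r s t (b b' : arrow s t) (a a' : arrow r s) :
  (b <= b')%O -> (a <= a')%O -> (arrow_comp b a <= arrow_comp b' a')%O.
Proof.
move=> /arrow_leP hb /arrow_leP ha; apply/arrow_leP => k.
by rewrite !nth_arrow_comp; case: ifP.
Qed.

(* a_i = 0, for r < i <= s *)
Definition zero_at r s (a : arrow r s) (i : nat) : bool :=
  (r < i <= s) && (nth ord0 a (s - i) == ord0).

Lemma zero_at_comp r s t (b : arrow s t) (a : arrow r s) i :
  zero_at (arrow_comp b a) i = zero_at b i || zero_at a i.
Proof.
have h1 := arrow_leq a; have h2 := arrow_leq b.
rewrite /zero_at nth_arrow_comp; have [lt_si|le_is] := ltnP s i; last first.
  have -> : (t - i < t - s) = false by lia.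
  have -> : t - i - (t - s) = s - i by lia.
  by rewrite /= (leq_trans le_is h2).
rewrite andbF orbF /=; have -> : r < i by lia.
case le_it : (i <= t) => //=; suff -> : t - i < t - s by [].
by lia.
Qed.

Lemma zero_at_le r s (a b : arrow r s) i : (a <= b)%O -> zero_at b i -> zero_at a i.
Proof.
move=> /arrow_leP le_ab /andP[ri /eqP bi]; rewrite /zero_at ri /=.
by apply/eqP/val_inj/eqP; rewrite /= -leqn0; have := le_ab (s - i); rewrite bi.
Qed.

Lemma zero_at_last r s (a : arrow r s) : r < s -> zero_at a s.
Proof.
by move=> lt_rs; rewrite /zero_at lt_rs leqnn subnn nth0 arrow_head eqxx.
Qed.

Definition bit (z : bool) : 'I_2 := if z then ord0 else ord_max.

Lemma bitK (x : 'I_2) : bit (x == ord0) = x.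
Proof. by apply: val_inj; case: x => [[|[|]]]. Qed.

Lemma bit_eq0 z : (bit z == ord0) = z. Proof. by case: z. Qed.

(* The functor induced by an operator f sends a to the arrow whose zeros in
   (f r, f s] are the images under f of the zeros of a: since a is the composite of
   the generators <z_j, z_(j+1)> between r and its successive zeros, this is the
   composite of the <f z_j, f z_(j+1)>; see arrow_map_gen, arrow_map_id and
   arrow_map_comp. *)
Definition image_zero m n (f : operator m n) (r s : 'I_m.+1) (a : arrow r s)
    (j : nat) : bool :=
  [exists i : 'I_m.+1, zero_at a i && (f i == j :> nat)].

Program Definition arrow_map m n (f : operator m n) (r s : 'I_m.+1) (a : arrow r s) :
  arrow (f r) (f s) :=
  @Arrow (f r) (f s) (mkseq (fun k => bit (image_zero f a (f s - k))) (f s - f r)) _.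
Next Obligation.
move=> m n f r s a; have le_rs := arrow_leq a.
rewrite /arrow_pred (op_le f le_rs) size_mkseq eqxx /=.
case E : (f s - f r) => [|k] //=; rewrite bit_eq0 subn0.
apply/existsP; exists s; rewrite eqxx andbT zero_at_last // ltn_neqAle le_rs andbT.
by apply/eqP => /val_inj e; move: E; rewrite e subnn.
Qed.

Lemma nth_arrow_map m n (f : operator m n) (r s : 'I_m.+1) (a : arrow r s) k :
  k < f s - f r -> nth ord0 (arrow_map f a) k = bit (image_zero f a (f s - k)).
Proof. by move=> lt_k; rewrite nth_mkseq. Qed.

Lemma zero_at_map m n (f : operator m n) (r s : 'I_m.+1) (a : arrow r s) j :
  zero_at (arrow_map f a) j = (f r < j <= f s) && image_zero f a j.
Proof.
rewrite /zero_at; case H : (f r < j <= f s) => //=.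
by rewrite nth_arrow_map ?bit_eq0; [rewrite subKn //|]; lia.
Qed.

Lemma zero_at_ext r s (a b : arrow r s) : zero_at a =1 zero_at b -> a = b.
Proof.
move=> e; apply: arrow_ext => k lt_k.
have := e (s - k); rewrite /zero_at subKn; last by lia.
have -> : r < s - k <= s by lia.
by rewrite /= => e'; rewrite -[LHS]bitK e' bitK.
Qed.

Lemma arrow_map_le m n (f : operator m n) (r s : 'I_m.+1) (a b : arrow r s) :
  (a <= b)%O -> (arrow_map f a <= arrow_map f b)%O.
Proof.
move=> le_ab; apply/arrow_leP => k; have [lt_k|le_k] := ltnP k (f s - f r); last first.
  by rewrite !nth_default ?size_arrow.
rewrite !nth_arrow_map //.
case Hb : (image_zero f b _); last by rewrite -ltnS ltn_ord.
suff -> : image_zero f a (f s - k) by [].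
have /existsP[i /andP[zi ei]] := Hb; apply/existsP; exists i.
by rewrite (zero_at_le le_ab).
Qed.

Lemma arrow_map_id m n (f : operator m n) (r : 'I_m.+1) :
  arrow_map f (arrow_id r) = arrow_id (f r).
Proof. by apply: arrow_ext => k; rewrite subnn. Qed.

Lemma arrow_map_comp m n (f : operator m n) (r s t : 'I_m.+1)
    (b : arrow s t) (a : arrow r s) :
  arrow_map f (arrow_comp b a) = arrow_comp (arrow_map f b) (arrow_map f a).
Proof.
have le_rs := arrow_leq a; have le_st := arrow_leq b.
have fle_rs := op_le f le_rs; have fle_st := op_le f le_st.
apply: zero_at_ext => j; rewrite zero_at_comp !zero_at_map.
apply/andP/orP => [[rng /existsP[i /andP[]]]|].
  rewrite zero_at_comp => /orP[] zi /eqP ei; last first.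
    right; apply/andP; split; last by apply/existsP; exists i; rewrite zi ei eqxx.
    move: (zi) => /andP[/andP[_ le_is] _]; have := op_le f le_is; lia.
  have [lt_sj|le_js] := ltnP (f s) j.
    left; apply/andP; split; first by lia.
    by apply/existsP; exists i; rewrite zi ei eqxx.
  right; apply/andP; split; first by lia.
  have esj : f s = j :> nat.
    move: (zi) => /andP[/andP[lt_si _] _]; have := op_le f (ltnW lt_si); lia.
  apply/existsP; exists s; rewrite esj eqxx andbT zero_at_last //.
  rewrite ltn_neqAle le_rs andbT; apply/eqP => /val_inj e.
  by move: rng; rewrite e esj ltnn.
case=> /andP[rng /existsP[i /andP[zi ei]]].
  split; first by lia.
  by apply/existsP; exists i; rewrite zero_at_comp zi ei.
split; first by lia.
by apply/existsP; exists i; rewrite zero_at_comp zi ei orbT.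
Qed.

Lemma zero_at_gen r s (le_rs : r <= s) i :
  zero_at (arrow_gen le_rs) i = (r < s) && (i == s).
Proof.
rewrite /zero_at /=; have [->|ne] := eqVneq i s.
  by rewrite leqnn subnn andbT; case: (s - r) => //=; rewrite ?eqxx ?andbT.
rewrite andbF; case H : (r < i <= s) => //=.
case E : (s - r) => [|k] /=; first by lia.
have -> : s - i = (s - i).-1.+1 by lia.
by rewrite /= nth_nseq; suff -> : (s - i).-1 < k by []; lia.
Qed.

Lemma arrow_map_gen m n (f : operator m n) (r s : 'I_m.+1) (le_rs : r <= s) :
  arrow_map f (arrow_gen le_rs) = arrow_gen (op_le f le_rs).
Proof.
apply: zero_at_ext => j; rewrite zero_at_map zero_at_gen.
apply/andP/andP => [[rng /existsP[i /andP[]]]|[lt_f /eqP ->]].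
  rewrite zero_at_gen => /andP[lt_rs /eqP /val_inj ->] /eqP ej.
  by rewrite -ej eqxx; split=> //; lia.
rewrite lt_f leqnn; split=> //; apply/existsP; exists s.
rewrite zero_at_gen !eqxx !andbT ltn_neqAle le_rs andbT.
by apply/eqP => /val_inj e; move: lt_f; rewrite e ltnn.
Qed.

(* The tensor power Delta[1] (x) (Delta[1] (x) (... (x) Delta[0])): the leftmost factor
   carries the coordinate a_s. *)
Fixpoint cube (k : nat) : strat :=
  if k is k'.+1 then tensor (Delta 1) (cube k') else Delta 0.

Definition point n : Delta 0 n := omk (fun x y (_ : (x <= y)%O) => lexx (ord0 : 'I_1)).

Lemma point_uniq n (u : Delta 0 n) : u = point n.
Proof. by apply: omorphism_ext => i; rewrite !ord1. Qed.

(* The simplex (x 0, x 1, ..., x (k - 1)). *)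
Fixpoint cube_simplex k n (x : nat -> Delta 1 n) : cube k n :=
  if k is k'.+1 then (x 0, cube_simplex k' (fun j => x j.+1)) else point n.

Lemma cube_simplex_act k m n (x : nat -> Delta 1 n) (a : operator m n) :
  act (cube_simplex k x) a = cube_simplex k (fun j => act (x j) a).
Proof.
elim: k x => [|k IH] x /=; first exact: point_uniq.
by congr pair; apply: IH.
Qed.

Lemma arrow_coord_subproof r s n (x : nerve_poset (arrow r s) n) (k : nat) :
  {homo (fun i => nth ord0 (x i) k) : i j / (i <= j)%O}.
Proof.
by move=> i j le_ij; rewrite ord_le; apply/arrow_leP; apply: omorph_le.
Qed.

Definition arrow_coord r s n (x : nerve_poset (arrow r s) n) (k : nat) : Delta 1 n :=
  omk (@arrow_coord_subproof r s n x k).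

(* The inclusion of the nerve of arrow r s into the cube of dimension s - r, sending
   a simplex to the tuple of its coordinates. *)
Program Definition arrow_cube r s : smap (nerve_poset (arrow r s)) (cube (s - r)) :=
  @SMap (nerve_poset (arrow r s)) (cube (s - r))
    (fun n x => cube_simplex (s - r) (arrow_coord x)) _.
Next Obligation.
move=> r s m n x a /=; rewrite cube_simplex_act; congr cube_simplex.
by apply: funext => k; apply: omorphism_ext.
Qed.

Lemma cube_simplex_inj k n (x y : nat -> Delta 1 n) j :
  cube_simplex k x = cube_simplex k y -> j < k -> x j = y j.
Proof.
elim: k x y j => // k IH x y [|j] [e0 e1] //= lt_j.
exact: (IH (fun i => x i.+1) (fun i => y i.+1)).
Qed.

Lemma arrow_cube_inj r s n : injective (arrow_cube r s n).
Proof.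
move=> x y exy; apply: omorphism_ext => i; apply: arrow_ext => k lt_k.
have /(congr1 (fun z : Delta 1 n => z i)) := cube_simplex_inj exy lt_k.
by [].
Qed.

Definition S_hom (r s : nat) : strat := strat_along (arrow_cube r s).

(* By nthin_cube, an n-simplex of a cube is not thin iff for some c 0 < ... < c (n - 1)
   each coordinate c j jumps from 0 to 1 between the vertices j and j + 1. *)
Definition jumps n k (v : nat -> nat -> nat) (c : nat -> nat) : Prop :=
  (forall j, j < n -> [/\ c j < k, v (c j) j = 0 & v (c j) j.+1 = 1]) /\
  (forall i j, i < j -> j < n -> c i < c j).

Definition vals n (x : nat -> Delta 1 n) (k i : nat) : nat := x k (inord i).

Lemma degenerate_DeltaP k n (x : Delta k n) :
  degenerate x <-> exists2 i, i < n & x (inord i) = x (inord i.+1).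
Proof.
split=> [[m [s [y [lt_mn _ ->]]]]|[i lt_in e]].
  by have [i lt_in e] := op_collapse s lt_mn; exists i => //=; rewrite e.
have -> : x = @act (Delta k) _ _ (oid _) x by apply: omorphism_ext.
exact: degenerate_step e.
Qed.

Lemma nthin_Delta1 p (x : Delta 1 p) :
  ~ degenerate x <->
  p = 0 \/ [/\ p = 1, x (inord 0) = 0 :> nat & x (inord 1) = 1 :> nat].
Proof.
rewrite degenerate_DeltaP; split.
  move=> nd; have st i : i < p -> x (inord i) < x (inord i.+1).
    move=> lt_ip; rewrite ltn_neqAle; apply/andP; split.
      by apply/eqP => /val_inj e; apply: nd; exists i.
    by apply: op_le; rewrite !inordK; lia.
  case: p x nd st => [|[|p]] x nd st; first by left.
    right; have := st 0 isT; have := ltn_ord (x (inord 1)).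
    by split=> //; lia.
  have := st 0 isT; have := st 1 isT; have := ltn_ord (x (inord 2)); lia.
case=> [p0|[p1 e0 e1]] [i lt_ip]; first by lia.
have -> : i = 0 by lia.
by move=> /(congr1 val) /=; rewrite e0 e1.
Qed.

Lemma nthin_cube k n (x : nat -> Delta 1 n) :
  ~ thin (cube_simplex k x) <-> exists c, jumps n k (vals x) c.
Proof.
elim: k n x => [|k IH] n x /=.
  split=> [nd|[c [h _]] d].
    exists id; split=> // j lt_jn; case: nd; apply/degenerate_DeltaP.
    by exists j => //; rewrite !ord1.
  by have [i lt_in _] := (degenerate_DeltaP _).1 d; have [] := h _ lt_in.
have key p q (e : p + q = n) :
    ~ (thin (act (x 0) (bot1 e)) \/
       thin (act (cube_simplex k (fun j => x j.+1)) (bot2 e))) <->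
    (p = 0 \/ [/\ p = 1, vals x 0 0 = 0 & vals x 0 1 = 1]) /\
    exists c, jumps q k (fun j i => vals x j.+1 (i + p)) c.
  have lt_p i : i <= p -> i < n.+1 by lia.
  have v0 i : i <= p -> val (act (x 0) (bot1 e) (inord i)) = vals x 0 i.
    by move=> le_ip; rewrite /= inordK.
  have v1 j i : i <= q ->
      vals (fun j => act (x j.+1) (bot2 e)) j i = vals x j.+1 (i + p).
    by move=> le_iq; rewrite /vals /= inordK.
  have E1 := nthin_Delta1 (act (x 0) (bot1 e)).
  have E2 := IH q (fun j => act (x j.+1) (bot2 e)).
  rewrite cube_simplex_act not_orP; split=> -[h1 h2]; split.
  - case: (E1.1 h1) => [|[p1 e0 e1]]; [by left | right].
    by split=> //; rewrite -v0 // p1.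
  - have [c [hc ic]] := E2.1 h2; exists c; split=> // j lt_jq.
    by have [k1 k2 k3] := hc j lt_jq; split=> //; rewrite -v1 //; lia.
  - apply/E1; case: h1 => [|[p1 e0 e1]]; [by left | right].
    by split=> //; [apply: etrans e0 | apply: etrans e1]; apply: v0; rewrite p1.
  - apply/E2; have [c [hc ic]] := h2; exists c; split=> // j lt_jq.
    by have [k1 k2 k3] := hc j lt_jq; split=> //; rewrite v1 //; lia.
split.
  move=> nt; have [p [q [e]]] : exists p q (e : p + q = n),
      ~ (thin (act (x 0) (bot1 e)) \/
         thin (act (cube_simplex k (fun j => x j.+1)) (bot2 e))).
    apply: contrapT => no; apply: nt => p q e.
    by apply: contrapT => h; apply: no; exists p, q, e.
  move/key => [hp [c [hc ic]]].
  have [p0|[p1 e0 e1]] := hp.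
    exists (fun j => (c j).+1); split.
      move=> j lt_jn; have lt_jq : j < q by lia.
      by have [k1] := hc j lt_jq; rewrite p0 !addn0.
    move=> i j lt_ij lt_jn; have lt_jq : j < q by lia.
    by have := ic i j lt_ij lt_jq; lia.
  exists (fun j => if j is j'.+1 then (c j').+1 else 0); split.
    move=> [|j] lt_jn //; have lt_jq : j < q by lia.
    by have [k1] := hc j lt_jq; rewrite p1 !addn1.
  move=> [|i] [|j] // lt_ij lt_jn.
  have lt_jq : j < q by lia.
  by have := ic i j lt_ij lt_jq; lia.
move=> [c [hc ic]] h.
suff [p [q [e hk]]] : exists p q (e : p + q = n),
    (p = 0 \/ [/\ p = 1, vals x 0 0 = 0 & vals x 0 1 = 1]) /\
    exists c, jumps q k (fun j i => vals x j.+1 (i + p)) c.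
  by move/key: hk; apply; apply: h.
have shift i : 0 < c 0 -> i < n -> c i = (c i).-1.+1.
  by move=> c0; case: i => [|i] lt_in; [lia | have := ic 0 i.+1 isT lt_in; lia].
case: n x {key h} hc ic shift => [|n] x hc ic shift.
  by exists 0, 0, erefl; split; [left | exists id; split].
have [c0|c0] := posnP (c 0); last first.
  exists 0, n.+1, erefl; split; first by left.
  exists (fun j => (c j).-1); split=> [j lt_jn|i j lt_ij lt_jn].
    have [h1 h2 h3] := hc j lt_jn; rewrite !addn0 -shift //; split.
  have lt_in := ltn_trans lt_ij lt_jn.
  by have := ic i j lt_ij lt_jn; have := shift i c0 lt_in; have := shift j c0 lt_jn; lia.
have [_ e0 e1] := hc 0 isT; rewrite c0 in e0 e1.
exists 1, n, erefl; split; first by right.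
have pos j : j < n -> c j.+1 = (c j.+1).-1.+1.
  by move=> lt_jn; have := ic 0 j.+1 isT lt_jn; lia.
exists (fun j => (c j.+1).-1); split=> [j lt_jn|i j lt_ij lt_jn].
  have [h1 h2 h3] := hc j.+1 lt_jn; rewrite !addn1 -pos //; split.
have lt_in := ltn_trans lt_ij lt_jn.
by have := ic i.+1 j.+1 lt_ij lt_jn; have := pos i lt_in; have := pos j lt_jn; lia.
Qed.

Lemma nthin_S r s n (x : S_hom r s n) :
  ~ thin x <->
  exists c, jumps n (s - r) (fun k i => nth ord0 (x (inord i)) k) c.
Proof. exact: (nthin_cube _ (arrow_coord x)). Qed.

Program Definition S_id_smap r : smap (Delta 0) (S_hom r r) :=
  @SMap (Delta 0) (S_hom r r)
    (fun n u => omk (fun x y (_ : (x <= y)%O) => lexx (arrow_id r))) _.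
Next Obligation. by move=> r m n x a; apply: omorphism_ext. Qed.

Program Definition S_id r : stmap (Delta 0) (S_hom r r) :=
  @STMap (Delta 0) (S_hom r r) (S_id_smap r) _.
Next Obligation. by move=> r n x dx; apply/thin_degenerate/smap_degenerate. Qed.

Lemma S_comp_subproof r s t n (z : tensor (S_hom s t) (S_hom r s) n) :
  {homo (fun i => arrow_comp (z.1 i) (z.2 i)) : i j / (i <= j)%O}.
Proof. by move=> i j le_ij; apply: arrow_comp_le; apply: omorph_le. Qed.

Program Definition S_comp_smap r s t :
    smap (tensor (S_hom s t) (S_hom r s)) (S_hom r t) :=
  @SMap (tensor (S_hom s t) (S_hom r s)) (S_hom r t)
    (fun n z => omk (@S_comp_subproof r s t n z)) _.
Next Obligation. by move=> r s t m n x a; apply: omorphism_ext. Qed.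

Lemma first_index (P : pred nat) n : exists p,
  [/\ p <= n, forall j, j < p -> ~~ P j & p < n -> P p].
Proof.
elim: n => [|n [p [le_pn h1 h2]]]; first by exists 0.
have [lt_pn|le_np] := ltnP p n; first by exists p; split=> //; [lia | auto].
have {le_np}e : p = n by lia.
subst p; case Pn : (P n); first by exists n; split.
exists n.+1; split=> // [j|]; last by rewrite ltnn.
by rewrite ltnS leq_eqVlt => /orP[/eqP ->|/h1 //]; rewrite Pn.
Qed.

Program Definition S_comp r s t : stmap (tensor (S_hom s t) (S_hom r s)) (S_hom r t) :=
  @STMap (tensor (S_hom s t) (S_hom r s)) (S_hom r t) (S_comp_smap r s t) _.
Next Obligation.
move=> r s t n [b a] tba; apply: contrapT => /nthin_S[c [hc ic]].
have le_rs := arrow_leq (a ord0); have le_st := arrow_leq (b ord0).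
have val_c k i : nth ord0 (S_comp_smap r s t n (b, a) (inord i)) k =
    if k < t - s then nth ord0 (b (inord i)) k else nth ord0 (a (inord i)) (k - (t - s)).
  exact: nth_arrow_comp.
have [p [le_pn lo hi]] := first_index (fun j => t - s <= c j) n.
have [q e] : exists q, p + q = n by exists (n - p); lia.
have [] := tba p q e.
  apply/nthin_S; exists c; split=> [j lt_jp|i j lt_ij lt_jp]; last by apply: ic; lia.
  have lt_jn : j < n by lia.
  have := lo j lt_jp; rewrite -ltnNge => lt_c.
  have [_] := hc j lt_jn; rewrite !val_c lt_c => h0 h1; split=> //=.
    by apply: etrans h0; congr (nat_of_ord (nth _ (word (b _)) _)); apply: val_inj; rewrite /= !inordK; lia.
  by apply: etrans h1; congr (nat_of_ord (nth _ (word (b _)) _)); apply: val_inj; rewrite /= !inordK; lia.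
have hi' j : j < q -> t - s <= c (j + p).
  move=> lt_jq; have lt_pn : p < n by lia.
  have := hi lt_pn; case: j lt_jq => // j lt_jq.
  have := ic p (j.+1 + p); lia.
apply/nthin_S; exists (fun j => c (j + p) - (t - s)).
split=> [j lt_jq|i j lt_ij lt_jq]; last first.
  have lt_iq : i < q by lia.
  have := hi' j lt_jq; have := hi' i lt_iq; have := ic (i + p) (j + p).
  lia.
have lt_jn : j + p < n by lia.
have le_c := hi' j lt_jq.
have [lt_c] := hc _ lt_jn; rewrite !val_c ltnNge le_c /= => h0 h1; split=> //=.
- by lia.
- by apply: etrans h0; congr (nat_of_ord (nth _ (word (a _)) _)); apply: val_inj; rewrite /= !inordK; lia.
by apply: etrans h1; congr (nat_of_ord (nth _ (word (a _)) _)); apply: val_inj; rewrite /= !inordK; lia.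
Qed.

Lemma S_map_subproof m n (f : operator m n) (r s : 'I_m.+1) k (x : S_hom r s k) :
  {homo (fun i => arrow_map f (x i)) : i j / (i <= j)%O}.
Proof. by move=> i j le_ij; apply: arrow_map_le; apply: omorph_le. Qed.

Program Definition S_map_smap m n (f : operator m n) (r s : 'I_m.+1) :
    smap (S_hom r s) (S_hom (f r) (f s)) :=
  @SMap (S_hom r s) (S_hom (f r) (f s)) (fun k x => omk (@S_map_subproof m n f r s k x)) _.
Next Obligation. by move=> m n f r s k l x a; apply: omorphism_ext. Qed.

Program Definition S_map m n (f : operator m n) (r s : 'I_m.+1) :
    stmap (S_hom r s) (S_hom (f r) (f s)) :=
  @STMap (S_hom r s) (S_hom (f r) (f s)) (S_map_smap f r s) _.
Next Obligation.
move=> m n f r s k x tx; apply: contrapT => /nthin_S[c [hc ic]]; move: tx.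
pose sel j (i : 'I_m.+1) := zero_at (x (inord j)) i && (f i == f s - c j :> nat).
pose g j : 'I_m.+1 := odflt r [pick i | sel j i].
have gP j : j < k -> sel j (g j) /\ ~~ zero_at (x (inord j.+1)) (g j).
  move=> lt_jk; have [lt_c] := hc j lt_jk.
  rewrite [X in nat_of_ord X = 0 -> _]nth_arrow_map //.
  rewrite [X in _ -> nat_of_ord X = 1 -> _]nth_arrow_map //.
  case I0 : (image_zero f (x (inord j)) _) => // _.
  case I1 : (image_zero f (x (inord j.+1)) _) => // _.
  have {}I0 : sel j (g j).
    rewrite /g; case: pickP => [i //|no] /=.
    by have /existsP[i hi] := I0; have := no i; rewrite /sel hi.
  split=> //; apply/negP => z; have /negP[] := negbT I1.
  by apply/existsP; exists (g j); rewrite z; have /andP[_ ->] := I0.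
apply/nthin_S; exists (fun j => s - g j); split=> [j lt_jk|i j lt_ij lt_jk].
  have [/andP[/andP[/andP[lt1 le1] /eqP z0] _] z1] := gP j lt_jk.
  move: z1; rewrite /zero_at lt1 le1 /= => z1; split; [by lia | by rewrite z0 |].
  by move: z1; case: (nth _ _ _) => [[|[|]]].
have lt_ik := ltn_trans lt_ij lt_jk.
have [/andP[/andP[/andP[_ le_i] _] /eqP ei] _] := gP i lt_ik.
have [/andP[/andP[/andP[_ le_j] _] /eqP ej] _] := gP j lt_jk.
have lt_c := ic i j lt_ij lt_jk; have [lt_cj _ _] := hc j lt_jk.
suff lt_g : g j < g i by lia.
by rewrite ltnNge; apply/negP => /(op_le f); lia.
Qed.

Program Definition Sotimes (n : nat) : strat_category :=
  @StratCategory 'I_n.+1 (fun r s => S_hom r s) (fun r => S_id r)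
    (fun r s t => S_comp r s t) _ _ _.
Next Obligation.
move=> n r s k x u; apply: omorphism_ext => i; apply: val_inj; exact: cats0.
Qed.
Next Obligation.
by move=> n r s k x u; apply: omorphism_ext => i; apply: val_inj.
Qed.
Next Obligation.
move=> n r s t v k h g f; apply: omorphism_ext => i; apply: val_inj; exact: catA.
Qed.

Program Definition Sotimes_functor m n (f : operator m n) : strat_functor (Sotimes m) (Sotimes n) :=
  @StratFunctor (Sotimes m) (Sotimes n) f (fun r s => S_map f r s) _ _.
Next Obligation.
move=> m n f r k u; apply: omorphism_ext => i; exact: arrow_map_id.
Qed.
Next Obligation.
move=> m n f r s t k h g; apply: omorphism_ext => i; exact: arrow_map_comp.
Qed.

Lemma arrow_map_oid n (r s : 'I_n.+1) (a : arrow r s) : arrow_map (oid _) a = a.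
Proof.
apply: zero_at_ext => j; rewrite zero_at_map /=.
apply/andP/idP => [[rng /existsP[i /andP[zi /eqP <-]]]|zj] //.
have rng : r < j <= s by have /andP[] := zj.
split=> //; have lt_j : j < n.+1 by have := ltn_ord s; lia.
by apply/existsP; exists (Ordinal lt_j); rewrite zj /=.
Qed.

Lemma arrow_map_ocomp k m n (f : operator m n) (g : operator k m)
    (r s : 'I_k.+1) (a : arrow r s) :
  arrow_map (ocomp f g) a = arrow_map f (arrow_map g a).
Proof.
apply: zero_at_ext => j.
rewrite zero_at_map [RHS](@zero_at_map _ _ f (g r) (g s)) /=.
case rng : (f (g r) < j <= f (g s)) => //=.
rewrite /image_zero; apply/existsP/existsP => -[i /andP[]].
  move=> zi /eqP ei; exists (g i); rewrite ei eqxx andbT zero_at_map.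
  apply/andP; split; last by apply/existsP; exists i; rewrite zi eqxx.
  have /andP[/andP[_ le_is] _] := zi; rewrite (op_le g le_is) andbT ltnNge.
  by apply/negP => /(op_le f) h; have /andP[] := rng; rewrite -ei /= ltnNge h.
rewrite zero_at_map => /andP[_ /existsP[i' /andP[zi' /eqP /val_inj ei']]] ei.
by exists i'; rewrite zi' /= ei' ei.
Qed.

Program Definition nerve (E : strat_category) : sset :=
  @SSet (fun n => strat_functor (Sotimes n) E)
    (fun m n f a => strat_functor_comp f (Sotimes_functor a)) _ _.
Next Obligation.
move=> E n [F h h1 hM]; apply: StratFunctor_ext => r s k x /=.
congr (h r s k _); apply: omorphism_ext => i; exact: arrow_map_oid.
Qed.
Next Obligation.
move=> E k m n [F h h1 hM] a b; apply: StratFunctor_ext => r s l x /=.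
congr (h _ _ l _); apply: omorphism_ext => i; exact: arrow_map_ocomp.
Qed.

Program Definition nerve_map (E E' : strat_category) (G : strat_functor E E') :
    smap (nerve E) (nerve E') :=
  @SMap (nerve E) (nerve E') (fun n f => strat_functor_comp G f) _.
Next Obligation.
by move=> E E' G m n f a; apply: StratFunctor_ext.
Qed.

Program Definition nerve_functor : functor strat_cat_cat sset_cat :=
  @Functor strat_cat_cat sset_cat nerve nerve_map _ _.
Next Obligation.
by move=> E; apply: smap_ext => n [F h h1 hM]; apply: StratFunctor_ext.
Qed.
Next Obligation.
by move=> E E' E'' G F; apply: smap_ext => n f; apply: StratFunctor_ext.
Qed.

(* Main.v *)
(* A simplex f : Delta[n] -> E(x, y) extends to an n+1-simplex of N(E), namely a
   functor from S[n+1] sending 0, ..., n to x and n+1 to y.  On the homset from r to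
   n+1 it sends the word (0, a_n, ..., a_(r+1)) to the vertex of f indexed by the
   number of ones following the initial 0.  This number is unaffected by
   precomposition, since nonempty arrows begin with 0, and a chain of words along
   which it strictly increases is not thin.  The words
   (0, 1, ..., 1, 0, ..., 0) from 0 to n+1 are sent to f itself, so two functors
   inducing the same map of nerves agree on f. *)
From mathcomp Require Import all_boot all_order boolp zify.
Require Import Defs.

Set Implicit Arguments.
Unset Strict Implicit.
Unset Printing Implicit Defensive.

Import Order.Theory.

Local Obligation Tactic := idtac.

Definition lead (w : seq 'I_2) : nat := index ord0 (behead w).

Lemma lead_size (w : seq 'I_2) : lead w <= (size w).-1.
Proof. by rewrite -size_behead index_size. Qed.

Lemma nth_lead (w : seq 'I_2) : nth ord0 w (lead w).+1 = ord0.
Proof.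
rewrite -nth_behead; have [lt_w|ge_w] := ltnP (lead w) (size (behead w)).
  by apply: nth_index; rewrite -index_mem.
(* The tail has no 0, and the default [ord0] is read past its end. *)
by rewrite nth_default.
Qed.

Lemma nth_before_lead (w : seq 'I_2) k : k < lead w -> nth ord0 w k.+1 = 1 :> nat.
Proof.
move=> /(before_find ord0); rewrite nth_behead /=.
by case: (nth _ _ _) => [[|[|]]].
Qed.

(** Otherwise [a] would have a 1 at position [(lead b).+1], where [b] has 0. *)
Lemma lead_le r s (a b : arrow r s) : (a <= b)%O -> lead a <= lead b.
Proof.
move=> /arrow_leP le_ab; rewrite leqNgt; apply/negP => /nth_before_lead a1.
by have := le_ab (lead b).+1; rewrite a1 nth_lead.
Qed.

Lemma lead_comp r s t (b : arrow s t) (a : arrow r s) :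
  s < t -> lead (arrow_comp b a) = lead b.
Proof.
move=> lt_st; have := size_arrow b; have := arrow_head a.
rewrite /lead /=; case: (word b) => [|x w] /=; first by lia.
move=> a0 _; rewrite index_cat; case: ifP => // /negbT nw0.
suff -> : index ord0 a = 0 by rewrite addn0 (memNindex nw0).
by case: (word a) a0 => //= y v ->; rewrite eqxx.
Qed.

Lemma lead_bound n (s : 'I_n.+2) r (a : arrow r s) : lead a < n.+1.
Proof.
by have := lead_size a; rewrite size_arrow; have := ltn_ord s; lia.
Qed.

Lemma lead_op_subproof n (r s : 'I_n.+2) k (u : S_hom r s k) :
  {homo (fun i => Ordinal (lead_bound (u i))) : i j / (i <= j)%O}.
Proof. by move=> i j le_ij; rewrite ord_le; apply: lead_le; apply: omorph_le. Qed.

Program Definition lead_smap n (r s : 'I_n.+2) : smap (S_hom r s) (Delta n) :=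
  @SMap (S_hom r s) (Delta n) (fun k u => omk (@lead_op_subproof n r s k u)) _.
Next Obligation. by move=> n r s m k u a; apply: omorphism_ext => i; apply: val_inj. Qed.

Program Definition lead_map n (r s : 'I_n.+2) : stmap (S_hom r s) (Delta n) :=
  @STMap (S_hom r s) (Delta n) (lead_smap r s) _.
Next Obligation.
move=> n r s k u tu; apply: contrapT => /degenerate_DeltaP nd; move: tu.
pose l j := lead (u (inord j)).
have lt_l j : j < k -> l j < l j.+1.
  move=> lt_jk; rewrite ltn_neqAle; apply/andP; split; last first.
    by apply: lead_le; apply: omorph_le; rewrite ord_le !inordK; lia.
  by apply/eqP => e; apply: nd; exists j => //; apply: val_inj.
(* Coordinate [(l j).+1] holds the 0 ending the run of ones at vertex [j], and lies inside the
   longer run at vertex [j.+1]. *)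
apply/nthin_S; exists (fun j => (l j).+1); split=> [j lt_jk|i j lt_ij lt_jk].
  split; last exact: nth_before_lead (lt_l j lt_jk).
    by have := lt_l j lt_jk; have := lead_size (u (inord j.+1)); rewrite size_arrow -/(l _); lia.
  by rewrite nth_lead.
elim: j lt_ij lt_jk => // j IH lt_ij lt_jk.
have := lt_l j (ltnW lt_jk); have [lt_ij'|le_ji] := ltnP i j.
  by have := IH lt_ij' (ltnW lt_jk); lia.
by have -> : i = j by lia.
Qed.

(** The Yoneda map of [x], stratified because only degenerate simplices of [Delta n] are thin. *)
Program Definition simplex_map (X : strat) n (x : X n) : stmap (Delta n) X :=
  @STMap (Delta n) X (@SMap (Delta n) X (fun k u => act x u) _) _.
Next Obligation. by move=> X n x m k u a; rewrite -actM. Qed.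
Next Obligation.
by move=> X n x k u du; apply/thin_degenerate/smap_degenerate.
Qed.

Definition to_point n : stmap (Delta n) (Delta 0) :=
  simplex_map (X := Delta 0) (point n).

Section Cone.
Variables (E : strat_category) (x y : E) (n : nat) (f : hom x y n).

Definition cone_ob (b : bool) : E := if b then y else x.

(** The constant cases also start from [Delta n], so that every homset can be mapped in through
    [lead_map]. *)
Definition cone_map (b c : bool) : b ==> c -> stmap (Delta n) (hom (cone_ob b) (cone_ob c)) :=
  match b, c return b ==> c -> stmap (Delta n) (hom (cone_ob b) (cone_ob c)) with
  | true, true => fun _ => stmap_comp (cid y) (to_point n)
  | false, false => fun _ => stmap_comp (cid x) (to_point n)
  | false, true => fun _ => simplex_map f
  | true, false => fun h => False_rect _ (elimF idP erefl h)
  end.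

Lemma cone_map_id b (h : b ==> b) k (u : Delta n k) (v : Delta 0 k) :
  cone_map h k u = cid (cone_ob b) k v.
Proof. by case: b h => h /=; congr (cid _ k _); rewrite [RHS]point_uniq [LHS]point_uniq. Qed.

(** One factor is always an identity, so a unit law applies and only the parameter of the other has
    to match [u]: [v] when the middle object is [x], [w] when it is [y]. *)
Lemma cone_map_comp b c d (hbd : b ==> d) (hcd : c ==> d) (hbc : b ==> c) k
    (u v w : Delta n k) :
  (~~ c -> d -> u = v) -> (c -> u = w) ->
  cone_map hbd k u = ccomp _ _ _ k (cone_map hcd k v, cone_map hbc k w).
Proof.
case: b c d hbd hcd hbc => [] [] [] // hbd hcd hbc uv uw.
- by rewrite (cone_map_id hcd v (point k)) c1comp uw.
- by rewrite (cone_map_id hcd v (point k)) c1comp uw.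
- by rewrite (cone_map_id hbc w (point k)) ccomp1 uv.
- rewrite (cone_map_id hbc w (point k)) ccomp1.
  by rewrite (cone_map_id hbd u (point k)) (cone_map_id hcd v (point k)).
Qed.

Definition is_last (r : 'I_n.+2) : bool := n < r.

(** The implication can fail when the homset is empty, hence the argument [u], any vertex of which
    witnesses [r <= s]. *)
Lemma is_last_le (r s : 'I_n.+2) k (u : S_hom r s k) : is_last r ==> is_last s.
Proof.
by apply/implyP => lt_nr; apply: leq_trans lt_nr (arrow_leq (u ord0)).
Qed.

Program Definition cone_hom_smap (r s : 'I_n.+2) :
    smap (S_hom r s) (hom (cone_ob (is_last r)) (cone_ob (is_last s))) :=
  @SMap (S_hom r s) _ (fun k u => cone_map (is_last_le u) k (lead_map r s k u)) _.
Next Obligation.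
move=> r s m k u a; cbv beta.
by rewrite (bool_irrelevance (is_last_le _) (is_last_le u)) (sfun_nat (lead_map r s)) sfun_nat.
Qed.

Program Definition cone_hom (r s : 'I_n.+2) :
    stmap (S_hom r s) (hom (cone_ob (is_last r)) (cone_ob (is_last s))) :=
  @STMap (S_hom r s) _ (cone_hom_smap r s) _.
Next Obligation. by move=> r s k u tu; do 2!apply: stfun_thin. Qed.

Program Definition cone : strat_functor (Sotimes n.+1) E :=
  @StratFunctor (Sotimes n.+1) E (fun r => cone_ob (is_last r)) cone_hom _ _.
Next Obligation. by move=> r k u; apply: cone_map_id. Qed.
Next Obligation.
move=> r s t k h g; apply: cone_map_comp => [ns lt|ls].
  apply: omorphism_ext => i; apply: val_inj; apply: lead_comp.
  by move: ns lt; rewrite /is_last; lia.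
(* Here [s] and [t] are both [n.+1], so [h i] is the empty word. *)
apply: omorphism_ext => i; apply: val_inj => /=.
have := size_arrow (h i); have := ltn_ord t; move: ls; rewrite /is_last => ls lt_t.
by case: (word (h i)) => //= a w; lia.
Qed.

End Cone.

Section StairSimplex.
Variable n : nat.

Definition stair_word (i : nat) : seq 'I_2 :=
  ord0 :: nseq i ord_max ++ nseq (n - i) ord0.

Lemma stair_word_subproof (i : 'I_n.+1) :
  arrow_pred (ord0 : 'I_n.+2) (ord_max : 'I_n.+2) (stair_word i).
Proof.
apply/and3P; split=> //; rewrite [size _]/= size_cat !size_nseq subn0 /=.
by rewrite subnKC // -ltnS.
Qed.

Definition stair_arrow (i : 'I_n.+1) := Arrow (stair_word_subproof i).

Lemma stair_arrow_le : {homo stair_arrow : i j / (i <= j)%O}.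
Proof.
move=> i j; rewrite ord_le => le_ij; apply/arrow_leP => -[|k] //=.
rewrite !nth_cat !size_nseq !nth_nseq.
by do !case: ifP => //; lia.
Qed.

Definition stair : S_hom (ord0 : 'I_n.+2) (ord_max : 'I_n.+2) n := omk stair_arrow_le.

Lemma lead_stair : lead_map _ _ n stair = oid _.
Proof.
apply: omorphism_ext => i; apply: val_inj; rewrite /= /lead /= index_cat.
rewrite mem_nseq andbF size_nseq.
by case: (n - i) => [|m] /=; rewrite ?eqxx addn0.
Qed.

End StairSimplex.

(* The proof eob is arbitrary, so that it can be taken to be erefl as soon as the
   object maps of H and K are convertible. *)
Lemma fhom_cast (E E' : strat_category) (H K : strat_functor E E')
    (eHK : H = K) (eob : fobj H = fobj K) r s n (u : hom r s n) :
  eq_rect (fobj H) (fun o => hom (o r) (o s) n) (fhom H r s n u) (fobj K) eob =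
  fhom K r s n u.
Proof. by subst K; rewrite (Prop_irrelevance eob erefl). Qed.

Theorem lemma30 : faithful nerve_functor.
Proof.
rewrite /faithful /= => E E' F G eFG.
have eK n (h : strat_functor (Sotimes n) E) :
    strat_functor_comp F h = strat_functor_comp G h.
  exact: (congr1 (fun N : smap (nerve E) (nerve E') => N n h) eFG).
(* Each object [x] is vertex 0 of the cone on its identity 0-simplex. *)
have eob : fobj F = fobj G.
  apply: funext => x.
  exact (congr1 (fun K : strat_functor (Sotimes 1) E' => fobj K (ord0 : 'I_2))
    (eK 1 (cone (cid x 0 (point 0))))).
move: F G eob eK {eFG} => [fo hF hF1 hFM] [go hG hG1 hGM] /= eob; subst go => eK.
apply: StratFunctor_ext => x y n f.
pose a := cone_map (x := x) (y := y) f (is_last_le (stair n)) n (lead_map _ _ n (stair n)).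
have : hF _ _ n a = hG _ _ n a := fhom_cast (eK _ (cone f)) erefl (stair n).
rewrite {}/a lead_stair.
have : is_last (ord_max : 'I_n.+2) by exact: ltnSn.
have : ~~ is_last (ord0 : 'I_n.+2) by [].
(* The types depend on both booleans; with the implication generalized they can be destructed, and
   only the case from [x] to [y] survives, where [simplex_map f] is evaluated at the identity
   operator. *)
move: (is_last_le _).
case: (is_last ord0) => //; case: (is_last ord_max) => // h _ _.
by rewrite [cone_map _ _ _ _]act1.
Qed.
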